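(* Let $\alpha\in(0,1]$ and $\beta\in(0,\infty)$, and set $$R_2=\begin{cases}\dfrac{\alpha}{\alpha+2}, & \beta=\frac12,\\[2mm] \dfrac{(\alpha+2\beta+1)-\sqrt{(\alpha+2\beta+1)^2-4\alpha(1-2\beta)}}{2(1-2\beta)}, & \beta\neq\frac12.\end{cases}$$ Then for every $f\in\mathcal{BA}(\mathbb{D})$ with $f(z)=\sum_{k=0}^\infty a_kz^k$, it holds that $$\alpha|f(z)|+\beta\sum_{k=1}^{\infty}|a_k||z|^k\le 1\qquad\text{for all } z\in\mathbb{D}\text{ with }|z|=r\le R_2.$$
   Context: $\mathbb{D}=\{z\in\mathbb{C}:|z|<1\}$. $\mathcal{BA}(\mathbb{D})$ is the class of analytic functions $f(z)=\sum_{k=0}^\infty a_kz^k$ on $\mathbb{D}$ with $|f(z)|<1$ for all $z\in\mathbb{D}$. *)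

(* Defs.v *)
From Stdlib Require Import Reals.
From Coquelicot Require Import Coquelicot.
Local Open Scope R_scope.

Definition unit_disc (z : C) : Prop := Cmod z < 1.

(* The explicit arguments select the complex scalar structure on [C]
   (Coquelicot also has a real one). *)
Definition is_power_series (a : nat -> C) (z l : C) : Prop :=
  @is_pseries C_AbsRing C_NormedModule a z l.

Definition analytic_at (f : C -> C) (w : C) : Prop :=
  exists (c : nat -> C) (eps : R), 0 < eps /\
    forall z : C, Cmod (z - w)%C < eps -> is_power_series c (z - w)%C (f z).

(* [f] is total on [C]; its values outside the disc are irrelevant. *)
Definition BA (f : C -> C) : Prop :=
  (forall w : C, unit_disc w -> analytic_at f w) /\
  (forall z : C, unit_disc z -> Cmod (f z) < 1).

Definition expansion_on_disc (f : C -> C) (a : nat -> C) : Prop :=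
  forall z : C, unit_disc z -> is_power_series a z (f z).

Definition R2 (alpha beta : R) : R :=
  if Req_EM_T beta (1 / 2) then alpha / (alpha + 2)
  else ((alpha + 2 * beta + 1)
        - sqrt ((alpha + 2 * beta + 1) ^ 2 - 4 * alpha * (1 - 2 * beta)))
       / (2 * (1 - 2 * beta)).

(* Main.v *)
Require Import Defs.
From Stdlib Require Import Reals Lra Lia.
From Coquelicot Require Import Coquelicot.
Local Open Scope R_scope.

(** Write [A = |a_0|] and [r = |z|].  Two sharp classical facts about a function
    bounded by 1 on the disc reduce the theorem to elementary algebra: the
    coefficient bound [|a_k| <= 1 - A ^ 2] for [k >= 1] ([coefficient_bound]) and
    the Schwarz-Pick inequality [|f z| <= (A + r) / (1 + A r)]
    ([Schwarz_Pick_at_0]).  The series is then at most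
    [(1 - A ^ 2) r / (1 - r)].  The condition [r <= R2] means that
    [2 beta r (1 + r) <= (alpha - r) (1 - r)] ([R2_quadratic]), which is exactly
    what [majorant_le_1] needs to bound the resulting expression by 1
    whenever [0 <= A < 1].

    Both facts are read off from one inequality, [Toeplitz_contraction]: the
    lower triangular Toeplitz matrices of the coefficients [a] are contractions
    for the Euclidean norm.  Its proof is finite.  At enough roots of unity the
    mean square of a polynomial is the sum of its squared coefficients
    ([Parseval_discrete]), so multiplication by a partial sum of [f], which is
    nearly bounded by 1 on a circle of radius less than 1, can barely increase
    that sum.  Refining the partial sum and letting the radius tend to 1 gives the
    contraction without complex integration or the maximum principle.

    A vector with two nonzero entries tests the coefficient [a_k] against [a_0].
    A reversed reproducing kernel at [z], with its last entry modified, tests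
    [f z] against [f 0] and amounts to the positivity of the two-point Pick
    matrix. *)


(** * Finite sums of complex and real numbers *)

(** Goals produced by [sum_n] carry the carrier of an abstract monoid as their
    type, which [ring] does not recognise as [C]. *)
Ltac C_ring :=
  lazymatch goal with |- @eq _ ?x ?y => change (@eq C x y) end; ring.

Lemma Csum_S (f : nat -> C) n : sum_n f (S n) = (sum_n f n + f (S n))%C :> C.
Proof. exact (sum_Sn f n). Qed.

Lemma Rsum_S (f : nat -> R) n : sum_n f (S n) = sum_n f n + f (S n).
Proof. exact (sum_Sn f n). Qed.

Lemma Csum_scal_l (c : C) (f : nat -> C) n :
  sum_n (fun k => c * f k)%C n = (c * sum_n f n)%C :> C.
Proof. exact (sum_n_mult_l (K := C_Ring) c f n). Qed.

Lemma Rsum_scal_l (c : R) (f : nat -> R) n :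
  sum_n (fun k => c * f k) n = c * sum_n f n.
Proof. exact (sum_n_mult_l (K := R_Ring) c f n). Qed.

Lemma Rsum_le (f g : nat -> R) n :
  (forall k, (k <= n)%nat -> f k <= g k) -> sum_n f n <= sum_n g n.
Proof.
  induction n as [|n IH]; intros H.
  - rewrite !sum_O; apply H; lia.
  - rewrite !Rsum_S; apply Rplus_le_compat; [apply IH; intros|]; apply H; lia.
Qed.

Lemma Csum_zero (f : nat -> C) n :
  (forall k, (k <= n)%nat -> f k = RtoC 0) -> sum_n f n = RtoC 0 :> C.
Proof.
  induction n as [|n IH]; intros H.
  - rewrite sum_O; apply H; lia.
  - rewrite Csum_S, IH, H; try lia; [ring|]. intros; apply H; lia.
Qed.

Lemma Re_sum_n (f : nat -> C) n : Re (sum_n f n) = sum_n (fun k => Re (f k)) n.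
Proof.
  induction n as [|n IH]; [now rewrite !sum_O|].
  rewrite Csum_S, Rsum_S, <- IH; reflexivity.
Qed.

Lemma Cmod_sqr_plus (x y : C) :
  Cmod (x + y)%C ^ 2 = Cmod x ^ 2 + Cmod y ^ 2 + 2 * Re (x * Cconj y)%C.
Proof. rewrite !Cmod2_alt; destruct x, y; simpl; ring. Qed.

Lemma Cpow_pow_comm (w : C) j k : ((w ^ j) ^ k)%C = ((w ^ k) ^ j)%C.
Proof. rewrite <- !Cpow_mult_r; f_equal; lia. Qed.

Lemma C_geom_sum (x : C) n :
  (sum_n (fun j => x ^ j)%C n * (1 - x))%C = (1 - x ^ S n)%C.
Proof.
  induction n as [|n IH].
  - rewrite sum_O; simpl; ring.
  - rewrite Csum_S, Cmult_plus_distr_r, IH; simpl; ring.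
Qed.

(** * Roots of unity and the discrete Parseval identity *)

Definition unit_root (N : nat) : C :=
  (cos (2 * PI / INR N), sin (2 * PI / INR N)).

Lemma Cpow_cos_sin t n : ((cos t, sin t) ^ n)%C = (cos (INR n * t), sin (INR n * t)).
Proof.
  induction n as [|n IH].
  - simpl; rewrite Rmult_0_l, cos_0, sin_0; reflexivity.
  - rewrite Cpow_S, IH, S_INR, Rmult_plus_distr_r, Rmult_1_l, cos_plus, sin_plus.
    unfold Cmult; simpl; f_equal; ring.
Qed.

Lemma Cmod_unit_root N : Cmod (unit_root N) = 1.
Proof.
  unfold Cmod, unit_root; simpl.
  generalize (sin2_cos2 (2 * PI / INR N)); unfold Rsqr; intros H.
  rewrite !Rmult_1_r, Rplus_comm, H; apply sqrt_1.
Qed.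

Lemma unit_root_pow_N N : (0 < N)%nat -> (unit_root N ^ N)%C = RtoC 1.
Proof.
  intros HN; unfold unit_root; rewrite Cpow_cos_sin.
  replace (INR N * (2 * PI / INR N)) with (2 * PI)
    by (field; apply not_0_INR; lia).
  rewrite cos_2PI, sin_2PI; reflexivity.
Qed.

Lemma unit_root_pow_neq_1 N d : (0 < d < N)%nat -> (unit_root N ^ d)%C <> RtoC 1.
Proof.
  intros Hd E; unfold unit_root in E; rewrite Cpow_cos_sin in E.
  apply (f_equal fst) in E; simpl in E.
  set (x := INR d * (PI / INR N)).
  assert (HN : 0 < INR N) by (apply lt_0_INR; lia).
  assert (Hd0 : 0 < INR d) by (apply lt_0_INR; lia).
  assert (HdN : INR d < INR N) by (apply lt_INR; lia).
  assert (Hpi := PI_RGT_0).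
  replace (INR d * (2 * PI / INR N)) with (2 * x) in E by (unfold x; field; lra).
  rewrite cos_2a_sin in E.
  assert (Hx : 0 < sin x).
  { apply sin_gt_0.
    - unfold x; apply Rmult_lt_0_compat; [lra|]. now apply Rdiv_lt_0_compat.
    - unfold x. replace (INR d * (PI / INR N)) with (PI * (INR d / INR N)) by (field; lra).
      rewrite <- (Rmult_1_r PI) at 2. apply Rmult_lt_compat_l; [lra|].
      apply Rmult_lt_reg_r with (INR N); [lra|].
      replace (INR d / INR N * INR N) with (INR d) by (field; lra). lra. }
  nra.
Qed.

(** The summand is [x ^ j] with [x] the conjugate of [w ^ (n - k)], a root of
    unity of order dividing [S D] and different from 1, so the geometric sum
    vanishes. *)
Lemma unit_root_orthogonal D k n : (k < n <= D)%nat ->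
  let w := unit_root (S D) in
  sum_n (fun j => (w ^ j) ^ k * Cconj ((w ^ j) ^ n))%C D = RtoC 0 :> C.
Proof.
  intros Hk w.
  set (x := Cconj (w ^ (n - k))).
  assert (Hw : (w * Cconj w = 1)%C).
  { unfold w; rewrite <- Cmod2_conj, Cmod_unit_root. simpl; f_equal; ring. }
  rewrite (sum_n_ext _ (fun j => x ^ j)%C).
  2:{ intros j. rewrite !(Cpow_pow_comm w j), (Cpow_conj (w ^ n)), <- Cpow_mult_l.
      f_equal. unfold x. replace n with (k + (n - k))%nat at 1 by lia.
      rewrite Cpow_add_r, Cmult_conj, Cmult_assoc, Cpow_conj, <- Cpow_mult_l, Hw, Cpow_1_l.
      ring. }
  assert (Hx : x <> RtoC 1).
  { intros E. apply (unit_root_pow_neq_1 (S D) (n - k)); [lia|].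
    fold w. rewrite <- (Cconj_conj (w ^ (n - k))). fold x. rewrite E.
    unfold Cconj, RtoC; simpl; f_equal; ring. }
  assert (HN : (x ^ S D = 1)%C).
  { unfold x, w. rewrite <- Cpow_conj, Cpow_pow_comm, unit_root_pow_N, Cpow_1_l; [|lia].
    unfold Cconj, RtoC; simpl; f_equal; ring. }
  generalize (C_geom_sum x D); rewrite HN; intros E.
  assert (H1 : (1 - x)%C <> RtoC 0).
  { intros E'. apply Hx. replace x with (1 - (1 - x))%C by ring. rewrite E'; ring. }
  replace (1 - 1)%C with (RtoC 0) in E by ring.
  set (s := sum_n (fun j => x ^ j)%C D : C) in *. change (s = RtoC 0).
  transitivity (s * (1 - x) / (1 - x))%C; [field; auto|].
  rewrite E; unfold Cdiv; ring.
Qed.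

Definition poly_eval (p : nat -> C) (n : nat) (z : C) : C :=
  sum_n (fun k => p k * z ^ k)%C n.

(** The [S D] nodes separate all exponents up to [D].  Adding the monomial of
    degree [S n] contributes its own square plus a cross term, which orthogonality
    kills after the two sums are exchanged. *)
Lemma Parseval_discrete (p : nat -> C) D n : (n <= D)%nat ->
  sum_n (fun j => Cmod (poly_eval p n (unit_root (S D) ^ j)%C) ^ 2) D
  = INR (S D) * sum_n (fun k => Cmod (p k) ^ 2) n.
Proof.
  set (w := unit_root (S D)).
  assert (Hmod : forall j k, Cmod ((w ^ j) ^ k)%C = 1).
  { intros; unfold w; rewrite !Cmod_pow, Cmod_unit_root, !pow1; reflexivity. }
  induction n as [|n IH]; intros Hn.
  - rewrite sum_O, <- sum_n_const. apply sum_n_ext; intros j.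
    unfold poly_eval; rewrite sum_O, Cmod_mult, Hmod, Rmult_1_r; reflexivity.
  - rewrite Rsum_S, Rmult_plus_distr_l, <- IH by lia.
    rewrite <- sum_n_const.
    set (cross := fun j =>
      (poly_eval p n (w ^ j) * Cconj (p (S n) * (w ^ j) ^ S n))%C).
    assert (Hc : sum_n cross D = RtoC 0 :> C).
    { unfold cross, poly_eval.
      rewrite (sum_n_ext _ (fun j => sum_n (fun k =>
        (p k * Cconj (p (S n))) * ((w ^ j) ^ k * Cconj ((w ^ j) ^ S n)))%C n)).
      2:{ intros j. rewrite Cmult_comm, <- Csum_scal_l. apply sum_n_ext; intros k.
          rewrite Cmult_conj; C_ring. }
      rewrite sum_n_switch. apply Csum_zero; intros k Hk.
      rewrite Csum_scal_l. unfold w. rewrite unit_root_orthogonal by lia. apply Cmult_0_r. }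
    transitivity (sum_n (fun j => plus (plus (Cmod (poly_eval p n (w ^ j)%C) ^ 2)
       (Cmod (p (S n)) ^ 2)) (2 * Re (cross j))) D).
    + apply sum_n_ext; intros j. unfold poly_eval at 1. rewrite Csum_S.
      rewrite Cmod_sqr_plus, Cmod_mult, Hmod, Rmult_1_r. reflexivity.
    + rewrite !sum_n_plus, Rsum_scal_l, <- Re_sum_n, Hc. unfold plus; simpl. ring.
Qed.


(** * Products of polynomials *)

Lemma Rsum_le_longer (f : nat -> R) n m :
  (n <= m)%nat -> (forall k, 0 <= f k) -> sum_n f n <= sum_n f m.
Proof.
  intros H Hf; induction H as [|m H IH]; [lra|].
  rewrite Rsum_S; specialize (Hf (S m)); lra.
Qed.

(** The coefficients of a product of power series; as a function of [q], the
    action of the lower triangular Toeplitz matrix with symbol [b]. *)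
Definition conv (b q : nat -> C) (n : nat) : C :=
  sum_n (fun i => b (n - i)%nat * q i)%C n.

Lemma sum_n_triangle {G : AbelianMonoid} (g : nat -> nat -> G) D :
  sum_n (fun n => sum_n (fun i => g i (n - i)%nat) n) D
  = sum_n (fun i => sum_n (g i) (D - i)) D.
Proof.
  induction D as [|D IH]; [now rewrite !sum_O|].
  rewrite sum_Sn, IH, sum_Sn.
  rewrite (sum_Sn (fun i => sum_n (g i) (S D - i))), plus_assoc.
  rewrite Nat.sub_diag, sum_O; f_equal.
  rewrite <- sum_n_plus; apply sum_n_ext_loc; intros n Hn.
  rewrite Nat.sub_succ_l by lia; now rewrite sum_Sn.
Qed.

Lemma Csum_extend (f : nat -> C) n m : (n <= m)%nat ->
  (forall k, (n < k)%nat -> f k = RtoC 0) -> sum_n f m = sum_n f n :> C.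
Proof.
  intros H Hf; induction H as [|m H IH]; [reflexivity|].
  rewrite Csum_S, IH, Hf by lia; C_ring.
Qed.

Lemma poly_eval_conv (b q : nat -> C) K L z :
  (forall m, (K < m)%nat -> b m = RtoC 0) ->
  (forall i, (L < i)%nat -> q i = RtoC 0) ->
  poly_eval (conv b q) (K + L) z = (poly_eval b K z * poly_eval q L z)%C.
Proof.
  intros Hb Hq; unfold poly_eval at 1.
  transitivity (sum_n (fun n => sum_n (fun i =>
    (q i * z ^ i) * (b (n - i)%nat * z ^ (n - i)))%C n) (K + L)).
  - apply sum_n_ext; intros n. rewrite Cmult_comm; unfold conv.
    rewrite <- Csum_scal_l; apply sum_n_ext_loc; intros i Hi.
    replace n with (i + (n - i))%nat at 1 by lia. rewrite Cpow_add_r; C_ring.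
  - rewrite (sum_n_triangle (fun i j => (q i * z ^ i) * (b j * z ^ j))%C).
    rewrite (Csum_extend _ L); [|lia|].
    + unfold poly_eval at 2. rewrite <- Csum_scal_l.
      apply sum_n_ext_loc; intros i Hi. rewrite Csum_scal_l, Cmult_comm; f_equal.
      apply Csum_extend; [lia|]. intros k Hk; rewrite Hb by lia; ring.
    + intros i Hi. rewrite Csum_scal_l, Hq by lia. ring.
Qed.

(** Multiplication by a polynomial bounded by [B] on the circle multiplies mean
    squares at roots of unity by at most [B ^ 2], and by the Parseval identity
    these means are sums of squared coefficients.  Only the first coefficients
    of the product are kept: the others contribute nonnegative terms. *)
Lemma poly_multiplier_contraction (b q : nat -> C) K L B :
  (forall m, (K < m)%nat -> b m = RtoC 0) ->
  (forall i, (L < i)%nat -> q i = RtoC 0) ->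
  (forall z, Cmod z = 1 -> Cmod (poly_eval b K z) <= B) ->
  sum_n (fun n => Cmod (conv b q n) ^ 2) L
  <= B ^ 2 * sum_n (fun i => Cmod (q i) ^ 2) L.
Proof.
  intros Hb Hq HB; set (D := (K + L)%nat).
  eapply Rle_trans; [apply (Rsum_le_longer _ L D); [unfold D; lia|intros; apply pow2_ge_0]|].
  assert (HN : 0 < INR (S D)) by (apply lt_0_INR; lia).
  apply Rmult_le_reg_l with (INR (S D)); [exact HN|].
  rewrite <- Parseval_discrete by lia.
  replace (INR (S D) * (B ^ 2 * sum_n (fun i => Cmod (q i) ^ 2) L))
    with (B ^ 2 * (INR (S D) * sum_n (fun i => Cmod (q i) ^ 2) L)) by ring.
  rewrite <- (Parseval_discrete q D L) by (unfold D; lia).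
  rewrite <- Rsum_scal_l. apply Rsum_le; intros j _.
  unfold D at 1; rewrite poly_eval_conv by assumption.
  rewrite Cmod_mult, Rpow_mult_distr.
  apply Rmult_le_compat_r; [apply pow2_ge_0|].
  apply pow_incr; split; [apply Cmod_ge_0|apply HB].
  rewrite Cmod_pow, Cmod_unit_root, pow1; reflexivity.
Qed.

(** * Convergence of power series *)

Lemma power_series_filterlim (a : nat -> C) (z l : C) :
  is_power_series a z l ->
  filterlim (fun n => poly_eval a n z : C_NormedModule) eventually (locally (l : C_NormedModule)).
Proof.
  intros H. apply filterlim_ext with (2 := H). intros n. unfold poly_eval.
  apply sum_n_ext; intros k.
  assert (E : forall k, pow_n (z : C_Ring) k = (z ^ k)%C :> C).
  { clear; intros k; induction k as [|k IH]; [reflexivity|]. simpl; now rewrite IH. }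
  change (pow_n (z : C_Ring) k * a k = a k * z ^ k)%C. rewrite E; ring.
Qed.

Lemma power_series_partial_sums (a : nat -> C) (z l : C) :
  is_power_series a z l -> forall eps, 0 < eps -> exists N, forall n, (N <= n)%nat ->
  Cmod (poly_eval a n z - l)%C < eps.
Proof.
  intros H eps He. apply power_series_filterlim in H.
  exact (proj1 (filterlim_locally_ball_norm _ _) H (mkposreal eps He)).
Qed.

Lemma power_series_terms_bounded (a : nat -> C) (z l : C) :
  is_power_series a z l -> exists M, forall n, Cmod (a n) * Cmod z ^ n <= M.
Proof.
  intros H. apply power_series_filterlim in H.
  destruct (filterlim_bounded (K := C_AbsRing) (V := C_NormedModule)
    (fun n => poly_eval a n z)) as [M HM]; [now exists l|].
  exists (M + M); intros n. rewrite <- Cmod_pow, <- Cmod_mult.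
  assert (H0 : forall n, Cmod (poly_eval a n z) <= M) by exact HM.
  destruct n as [|n].
  - generalize (H0 0%nat) (Cmod_ge_0 (poly_eval a 0 z)); unfold poly_eval; rewrite sum_O; lra.
  - replace (a (S n) * z ^ S n)%C with (poly_eval a (S n) z + - poly_eval a n z)%C.
    + eapply Rle_trans; [apply Cmod_triangle|]. rewrite Cmod_opp.
      now apply Rplus_le_compat.
    + unfold poly_eval; rewrite Csum_S. generalize (sum_n (fun k => (a k * z ^ k)%C) n : C).
      intros s; simpl; ring.
Qed.

(** Convergence at one point of larger modulus [s] bounds the terms there, hence
    dominates the terms at radius [rho] by a geometric sequence of ratio
    [rho / s]. *)
Lemma expansion_abs_cvg f a : expansion_on_disc f a ->
  forall rho, 0 <= rho < 1 -> ex_series (fun n => Cmod (a n) * rho ^ n).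
Proof.
  intros Ha rho Hrho. set (s := (1 + rho) / 2).
  assert (Hs : 0 < s < 1) by (unfold s; lra).
  assert (Hsm : Cmod (RtoC s) = s) by (rewrite Cmod_R; apply Rabs_pos_eq; lra).
  assert (Hd : unit_disc (RtoC s)) by (red; rewrite Hsm; lra).
  destruct (power_series_terms_bounded _ _ _ (Ha _ Hd)) as [M HM]. rewrite Hsm in HM.
  apply (ex_series_le (K := R_AbsRing) (V := R_CompleteNormedModule) _
    (fun n => M * (rho / s) ^ n)).
  - intros n. change (Rabs (Cmod (a n) * rho ^ n) <= M * (rho / s) ^ n).
    assert (H1 := Cmod_ge_0 (a n)).
    assert (H2 : 0 <= rho ^ n) by (apply pow_le; lra).
    rewrite Rabs_pos_eq by (apply Rmult_le_pos; lra).
    replace (Cmod (a n) * rho ^ n) with (Cmod (a n) * s ^ n * (rho / s) ^ n).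
    + apply Rmult_le_compat_r; [|apply HM]. apply pow_le, Rdiv_le_0_compat; lra.
    + rewrite Rmult_assoc, <- Rpow_mult_distr. do 2 f_equal. field; lra.
  - apply (ex_series_scal_l (K := R_AbsRing) M (fun n => (rho / s) ^ n)), ex_series_geom.
    assert (0 <= rho / s) by (apply Rdiv_le_0_compat; lra).
    rewrite Rabs_pos_eq by assumption. apply Rlt_div_l; unfold s in *; lra.
Qed.

(** The tail of the series at radius [rho] is dominated, uniformly on the circle,
    by the tail of the numerical series of absolute values. *)
Lemma partial_sums_bound f a :
  (forall z, unit_disc z -> Cmod (f z) < 1) -> expansion_on_disc f a ->
  forall rho eps L, 0 < rho < 1 -> 0 < eps -> exists K, (L <= K)%nat /\
  forall z, Cmod z = 1 -> Cmod (poly_eval a K (rho * z)%C) <= 1 + eps.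
Proof.
  intros Hf Ha rho eps L Hrho He.
  destruct (expansion_abs_cvg f a Ha rho ltac:(lra)) as [s Hs].
  set (S' := sum_n (fun n => Cmod (a n) * rho ^ n)) in *.
  assert (Hterm : forall n, 0 <= Cmod (a n) * rho ^ n).
  { intros n; apply Rmult_le_pos; [apply Cmod_ge_0|apply pow_le; lra]. }
  assert (Hle : forall N, S' N <= s).
  { intros N. apply (is_lim_seq_incr_compare S' s Hs).
    intros n; unfold S'; rewrite Rsum_S; specialize (Hterm (S n)); lra. }
  destruct (proj1 (filterlim_locally_ball_norm (K := R_AbsRing) (U := R_NormedModule) S' s)
    Hs (mkposreal (eps / 2) ltac:(lra))) as [K0 HK0].
  exists (max L K0); split; [lia|]. intros z Hz.
  set (K := max L K0).
  assert (HK : s - S' K < eps / 2).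
  { specialize (HK0 K ltac:(unfold K; lia)). change (Rabs (S' K - s) < eps / 2) in HK0.
    apply Rabs_def2 in HK0; lra. }
  assert (Hm : Cmod (rho * z)%C = rho).
  { rewrite Cmod_mult, Hz, Cmod_R, Rabs_pos_eq; lra. }
  assert (Hd : unit_disc (rho * z)%C) by (red; lra).
  destruct (power_series_partial_sums _ _ _ (Ha _ Hd) (eps / 2) ltac:(lra)) as [N0 HN0].
  set (N := max K N0). specialize (HN0 N ltac:(unfold N; lia)).
  assert (Hdiff : forall N, (K <= N)%nat ->
    Cmod (poly_eval a K (rho * z) - poly_eval a N (rho * z))%C <= S' N - S' K).
  { clear N HN0; intros N HN; induction HN as [|N HN IH].
    - unfold Cminus; rewrite Cplus_opp_r, Cmod_0; lra.
    - replace (S' (S N)) with (S' N + Cmod (a (S N)) * rho ^ S N)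
        by (unfold S'; now rewrite Rsum_S).
      replace (poly_eval a (S N) (rho * z)) with
        (poly_eval a N (rho * z) + a (S N) * (rho * z) ^ S N)%C
        by (unfold poly_eval; now rewrite Csum_S).
      replace (poly_eval a K (rho * z) -
        (poly_eval a N (rho * z) + a (S N) * (rho * z) ^ S N))%C with
        ((poly_eval a K (rho * z) - poly_eval a N (rho * z))
         + - (a (S N) * (rho * z) ^ S N))%C by ring.
      eapply Rle_trans; [apply Cmod_triangle|].
      rewrite Cmod_opp, Cmod_mult, Cmod_pow, Hm. lra. }
  specialize (Hdiff N ltac:(unfold N; lia)). specialize (Hle N). specialize (Hf _ Hd).
  set (PK := poly_eval a K _) in *. set (PN := poly_eval a N _) in *.
  set (F := f _) in *. replace PK with ((PK - PN) + ((PN - F) + F))%C by ring.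
  generalize (Cmod_triangle (PK - PN) ((PN - F) + F)) (Cmod_triangle (PN - F) F). lra.
Qed.

(** * The Toeplitz contraction *)

Lemma le_of_radius_limit X Y L :
  (forall d, 0 < d < 1 -> (1 - d) ^ L * X <= (1 + d) ^ 2 * Y) -> X <= Y.
Proof.
  intros H.
  assert (Hlim : forall g : R -> R, continuous g 0 ->
    filterlim g (at_right 0) (Rbar_locally (Finite (g 0)))).
  { intros g Hg. apply filterlim_filter_le_1 with (2 := Hg).
    intros P HP. apply filter_imp with (2 := HP). auto. }
  change (Rbar_le X Y).
  replace X with ((1 - 0) ^ L * X) by (rewrite Rminus_0_r, pow1; ring).
  replace Y with ((1 + 0) ^ 2 * Y) by ring.
  apply (filterlim_le (F := at_right 0) (fun d => (1 - d) ^ L * X) (fun d => (1 + d) ^ 2 * Y)).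
  - exists (mkposreal 1 Rlt_0_1). intros d Hd Hd0. apply H.
    change (Rabs (d - 0) < 1) in Hd. apply Rabs_def2 in Hd. lra.
  - apply (Hlim (fun d => (1 - d) ^ L * X)).
    apply (ex_derive_continuous (K := R_AbsRing) (V := R_NormedModule)). now auto_derive.
  - apply (Hlim (fun d => (1 + d) ^ 2 * Y)).
    apply (ex_derive_continuous (K := R_AbsRing) (V := R_NormedModule)). now auto_derive.
Qed.

(** This is the statement that multiplication by [f] is a contraction of the
    Hardy space, read on the first coefficients.  The circle of radius
    [rho = 1 - d] and a partial sum bounded there by [1 + d] give it with a
    factor [(1 + d) ^ 2] on the right and weights at least [rho ^ (2 * L)] on
    the left; both disappear as [d] tends to 0. *)
Theorem Toeplitz_contraction f a :
  (forall z, unit_disc z -> Cmod (f z) < 1) -> expansion_on_disc f a ->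
  forall (q : nat -> C) L,
  sum_n (fun n => Cmod (conv a q n) ^ 2) L <= sum_n (fun i => Cmod (q i) ^ 2) L.
Proof.
  intros Hf Ha q L. apply (le_of_radius_limit _ _ (2 * L)). intros d Hd.
  set (rho := 1 - d).
  assert (Hrho : 0 < rho < 1) by (unfold rho; lra).
  assert (Hrm : forall n, Cmod (RtoC rho ^ n)%C = rho ^ n).
  { intros n; rewrite Cmod_pow, Cmod_R, Rabs_pos_eq; lra. }
  assert (Hpow : forall n, 0 < rho ^ n <= 1).
  { intros n; split; [apply pow_lt; lra|]. rewrite <- (pow1 n). apply pow_incr; lra. }
  destruct (partial_sums_bound f a Hf Ha rho d L Hrho ltac:(lra)) as [K [HK HB]].
  (* Coefficients of the truncations on the circle of radius rho: rescaling by
     rho moves that circle to the unit circle. *)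
  set (b m := if Nat.leb m K then (a m * RtoC rho ^ m)%C else RtoC 0).
  set (p i := if Nat.leb i L then (q i * RtoC rho ^ i)%C else RtoC 0).
  assert (Hmain : sum_n (fun n => Cmod (conv b p n) ^ 2) L
    <= (1 + d) ^ 2 * sum_n (fun i => Cmod (p i) ^ 2) L).
  { apply (poly_multiplier_contraction b p K L).
    - intros m Hm; unfold b. destruct (Nat.leb_spec m K); [lia|reflexivity].
    - intros m Hm; unfold p. destruct (Nat.leb_spec m L); [lia|reflexivity].
    - intros z Hz. replace (poly_eval b K z) with (poly_eval a K (rho * z)%C); [now apply HB|].
      apply sum_n_ext_loc; intros m Hm; unfold b.
      destruct (Nat.leb_spec m K); [|lia]. rewrite Cpow_mult_l; C_ring. }
  assert (Hconv : forall n, (n <= L)%nat -> conv b p n = (RtoC rho ^ n * conv a q n)%C).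
  { intros n Hn; unfold conv. rewrite <- Csum_scal_l. apply sum_n_ext_loc; intros i Hi.
    unfold b, p. destruct (Nat.leb_spec (n - i) K); [|lia].
    destruct (Nat.leb_spec i L); [|lia].
    replace (RtoC rho ^ n)%C with (RtoC rho ^ (n - i) * RtoC rho ^ i)%C
      by (rewrite <- Cpow_add_r; f_equal; lia).
    C_ring. }
  apply Rle_trans with (sum_n (fun n => Cmod (conv b p n) ^ 2) L).
  - rewrite <- Rsum_scal_l. apply Rsum_le; intros n Hn.
    rewrite Hconv, Cmod_mult, Hrm, Rpow_mult_distr by assumption.
    apply Rmult_le_compat_r; [apply pow2_ge_0|].
    rewrite <- pow_mult. replace (2 * L)%nat with (n * 2 + (2 * L - n * 2))%nat by lia.
    rewrite pow_add. fold rho. generalize (Hpow (n * 2)%nat) (Hpow (2 * L - n * 2)%nat); nra.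
  - eapply Rle_trans; [apply Hmain|]. apply Rmult_le_compat_l; [apply pow2_ge_0|].
    apply Rsum_le; intros i Hi. apply pow_incr; split; [apply Cmod_ge_0|].
    unfold p. destruct (Nat.leb_spec i L); [|lia].
    rewrite Cmod_mult, Hrm. generalize (Hpow i) (Cmod_ge_0 (q i)); nra.
Qed.


(** * The coefficient bound *)

Lemma poly_eval_0 a n : poly_eval a n (RtoC 0) = a 0%nat.
Proof.
  induction n as [|n IH]; unfold poly_eval in *.
  - rewrite sum_O; simpl; C_ring.
  - rewrite Csum_S, IH; simpl; ring.
Qed.

Lemma expansion_at_0 f a : expansion_on_disc f a -> f (RtoC 0) = a 0%nat.
Proof.
  intros Ha. assert (Hd : unit_disc (RtoC 0)) by (red; rewrite Cmod_0; lra).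
  assert (H : Cmod (a 0%nat - f (RtoC 0))%C = 0).
  { apply Rle_antisym; [|apply Cmod_ge_0]. apply le_epsilon; intros eps He.
    destruct (power_series_partial_sums _ _ _ (Ha _ Hd) eps He) as [N HN].
    specialize (HN N (le_n N)). rewrite poly_eval_0 in HN. rewrite Rplus_0_l; now apply Rlt_le. }
  apply Cmod_eq_0 in H.
  replace (f (RtoC 0)) with (a 0%nat - (a 0%nat - f (RtoC 0)))%C by ring.
  rewrite H; ring.
Qed.

Lemma Cmod_a0_lt_1 f a :
  (forall z, unit_disc z -> Cmod (f z) < 1) -> expansion_on_disc f a ->
  Cmod (a 0%nat) < 1.
Proof.
  intros Hf Ha. rewrite <- (expansion_at_0 f a Ha).
  apply Hf. red; rewrite Cmod_0; lra.
Qed.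

Lemma sum_n_ends {G : AbelianMonoid} (g : nat -> G) k :
  (forall i, (0 < i <= k)%nat -> g i = zero) ->
  sum_n g (S k) = plus (g 0%nat) (g (S k)).
Proof.
  intros H. rewrite sum_Sn; f_equal.
  induction k as [|k IH]; [now rewrite sum_O|].
  rewrite sum_Sn, (H (S k)), plus_zero_r by lia. apply IH; intros i Hi; apply H; lia.
Qed.

(** The contraction is tested on [u + v z ^ (k+1)].  With [A = |a_0|] and
    [b = |a_(k+1)|], the choice [u = 1 - A ^ 2] and [v] the product of
    [a_(k+1)] by the conjugate of [a_0] makes the coefficient of order [k+1] of
    the image exactly [a_(k+1)]; coefficients 0 and [k+1] then give
    [A ^ 2 u ^ 2 + b ^ 2 <= u ^ 2 + A ^ 2 b ^ 2], that is [b <= u]. *)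
Theorem coefficient_bound f a :
  (forall z, unit_disc z -> Cmod (f z) < 1) -> expansion_on_disc f a ->
  forall k, Cmod (a (S k)) <= 1 - Cmod (a 0%nat) ^ 2.
Proof.
  intros Hf Ha k.
  assert (HA := Cmod_a0_lt_1 f a Hf Ha).
  assert (HA0 := Cmod_ge_0 (a 0%nat)). assert (Hb0 := Cmod_ge_0 (a (S k))).
  set (u := 1 - Cmod (a 0%nat) ^ 2).
  set (q i := if Nat.eqb i 0 then RtoC u else
              if Nat.eqb i (S k) then (Cconj (a 0%nat) * a (S k))%C else RtoC 0).
  assert (Hq : forall i, (0 < i <= k)%nat -> q i = RtoC 0).
  { intros i Hi; unfold q. destruct (Nat.eqb_spec i 0); [lia|].
    destruct (Nat.eqb_spec i (S k)); [lia|reflexivity]. }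
  assert (HqS : q (S k) = (Cconj (a 0%nat) * a (S k))%C).
  { unfold q; simpl; now rewrite Nat.eqb_refl. }
  assert (HT := Toeplitz_contraction f a Hf Ha q (S k)).
  rewrite (sum_n_ends (fun i => Cmod (q i) ^ 2)) in HT.
  2:{ intros i Hi; rewrite Hq, Cmod_0 by exact Hi. unfold zero; simpl; ring. }
  rewrite Rsum_S in HT.
  assert (H0 := Rsum_le_longer (fun n => Cmod (conv a q n) ^ 2) 0 k ltac:(lia)
    (fun n => pow2_ge_0 _)).
  rewrite sum_O in H0.
  assert (E0 : conv a q 0 = (a 0%nat * RtoC u)%C) by (unfold conv; now rewrite sum_O).
  assert (Ek : conv a q (S k) = a (S k)).
  { unfold conv. rewrite sum_n_ends.
    2:{ intros i Hi; rewrite Hq by exact Hi. apply Cmult_0_r. }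
    rewrite HqS, Nat.sub_diag, Nat.sub_0_r.
    change ((a (S k) * RtoC u + a 0%nat * (Cconj (a 0%nat) * a (S k)))%C = a (S k)).
    replace (RtoC u) with (1 - a 0%nat * Cconj (a 0%nat))%C; [ring|].
    rewrite <- Cmod2_conj. unfold u. now rewrite RtoC_minus. }
  rewrite Ek in HT. rewrite E0 in H0.
  change (plus (Cmod (q 0%nat) ^ 2) (Cmod (q (S k)) ^ 2))
    with (Cmod (RtoC u) ^ 2 + Cmod (q (S k)) ^ 2) in HT.
  rewrite HqS in HT. rewrite !Cmod_mult in *. rewrite Cmod_conj in HT.
  assert (Hu : 0 < u) by (unfold u; nra).
  rewrite !Cmod_R, Rabs_pos_eq in * by lra.
  set (A := Cmod (a 0%nat)) in *. set (b := Cmod (a (S k))) in *.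
  assert (H : u * (b ^ 2) <= u * u ^ 2) 
    by (replace (u * b ^ 2) with ((1 - A ^ 2) * b ^ 2) by reflexivity;
        replace (u * u ^ 2) with ((1 - A ^ 2) * u ^ 2) by reflexivity; lra).
  apply Rmult_le_reg_l in H; [|exact Hu].
  apply Rsqr_incr_0_var; [rewrite !Rsqr_pow2; exact H|lra].
Qed.

(** * The Schwarz-Pick inequality *)

(** The recursion [e = c e + x] has the fixed point [x / (1 - c)], which attracts
    [E].  Only the upper bound is proved: once [X] stays below [x + eta], the
    excess of [E] over the perturbed fixed point decays geometrically. *)
Lemma linear_recursion_limit (c x g : R) (E X G : nat -> R) :
  0 <= c < 1 -> (forall n, E (S n) = c * E n + X (S n)) ->
  is_lim_seq X x -> is_lim_seq G g -> (forall n, G n <= E n) ->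
  g <= x / (1 - c).
Proof.
  intros Hc HE HX HG Hle.
  apply le_epsilon; intros eps He.
  set (eta := eps * (1 - c)). assert (Heta : 0 < eta) by (unfold eta; nra).
  replace (x / (1 - c) + eps) with ((x + eta) / (1 - c)) by (unfold eta; field; lra).
  set (e := (x + eta) / (1 - c)).
  apply is_lim_seq_spec in HX. destruct (HX (mkposreal eta Heta)) as [N HN]; simpl in HN.
  assert (H : forall m, E (N + m)%nat - e <= c ^ m * (E N - e)).
  { induction m as [|m IH]; [rewrite Nat.add_0_r; simpl; lra|].
    rewrite Nat.add_succ_r, HE. specialize (HN (S (N + m)) ltac:(lia)).
    apply Rabs_def2 in HN. simpl.
    assert (Ee : e = c * e + (x + eta)) by (unfold e; field; lra). nra. }
  change (Rbar_le g e).
  apply (is_lim_seq_le (fun m => G (N + m)%nat) (fun m => e + c ^ m * (E N - e))).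
  - intros m; specialize (H m); specialize (Hle (N + m)%nat); lra.
  - apply (is_lim_seq_ext (fun m => G (m + N)%nat)); [intros; now rewrite Nat.add_comm|].
    now apply (is_lim_seq_incr_n G N).
  - replace (Finite e) with (Finite (e + 0 * (E N - e))) by (f_equal; ring).
    apply is_lim_seq_plus'; [apply is_lim_seq_const|].
    apply is_lim_seq_mult'; [|apply is_lim_seq_const].
    apply is_lim_seq_geom; rewrite Rabs_pos_eq; lra.
Qed.

Lemma sum_n_rev {G : AbelianMonoid} (g : nat -> G) n :
  sum_n (fun i => g (n - i)%nat) n = sum_n g n.
Proof.
  revert g; induction n as [|n IH]; intros g; [now rewrite !sum_O|].
  rewrite sum_Sn, Nat.sub_diag.
  rewrite (sum_n_ext_loc _ (fun i => g (S (n - i)))) by (intros; f_equal; lia).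
  rewrite (IH (fun i => g (S i))). clear IH.
  induction n as [|n IH]; [rewrite !sum_Sn, !sum_O; apply plus_comm|].
  rewrite sum_Sn, (sum_Sn g), <- IH, <- !plus_assoc. f_equal. apply plus_comm.
Qed.

Lemma is_lim_seq_Cmod_sqr_poly (a : nat -> C) (w l v : C) :
  is_power_series a w l ->
  is_lim_seq (fun n => Cmod (poly_eval a n w + v)%C ^ 2) (Cmod (l + v)%C ^ 2).
Proof.
  intros H. assert (Hm : is_lim_seq (fun n => Cmod (poly_eval a n w + v)%C) (Cmod (l + v)%C)).
  { apply is_lim_seq_spec; intros eps.
    destruct (power_series_partial_sums _ _ _ H eps (cond_pos eps)) as [N HN].
    exists N; intros n Hn; specialize (HN n Hn).
    set (p := poly_eval a n w) in *.
    generalize (Cmod_triangle (p - l) (l + v)) (Cmod_triangle (l - p) (p + v)).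
    replace (p - l + (l + v))%C with (p + v)%C by ring.
    replace (l - p + (p + v))%C with (l + v)%C by ring.
    replace (l - p)%C with (- (p - l))%C by ring. rewrite Cmod_opp.
    intros; apply Rabs_def1; lra. }
  simpl. apply is_lim_seq_mult'; [exact Hm|].
  apply is_lim_seq_mult'; [exact Hm|apply is_lim_seq_const].
Qed.

(** The test vector consists of the powers [w ^ (L - i)], with [u] added to its
    last entry.  It is the reversal of a truncated reproducing kernel at [w] plus
    a multiple of the kernel at 0: reversing a vector turns a lower triangular
    Toeplitz matrix into its transpose, for which kernels are nearly
    eigenvectors.  This shows in the entries of the image, which are
    [w ^ (L - n)] times the partial sums of [f w], except for the extra
    [u * a_0] in the last one. *)
Lemma kernel_test_vector f a :
  (forall z, unit_disc z -> Cmod (f z) < 1) -> expansion_on_disc f a ->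
  forall (w u : C) L,
  Cmod (poly_eval a L w + u * a 0%nat)%C ^ 2 - Cmod (poly_eval a L w) ^ 2
    + 1 - Cmod (1 + u)%C ^ 2
  <= sum_n (fun n => (Cmod w ^ 2) ^ (L - n) * (1 - Cmod (poly_eval a n w) ^ 2)) L.
Proof.
  intros Hf Ha w u L.
  set (q i := (w ^ (L - i) + (if Nat.eqb i L then u else RtoC 0))%C).
  set (P n := poly_eval a n w).
  assert (HT := Toeplitz_contraction f a Hf Ha q L).
  assert (Hconv : forall n, (n <= L)%nat ->
    conv a q n = (w ^ (L - n) * P n + (if Nat.eqb n L then u * a 0%nat else RtoC 0))%C).
  { intros n Hn; unfold conv, q.
    transitivity (plus (sum_n (fun i => w ^ (L - n) * (a (n - i)%nat * w ^ (n - i)))%C n)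
      (sum_n (fun i => a (n - i)%nat * (if Nat.eqb i L then u else RtoC 0))%C n)).
    - rewrite <- sum_n_plus. apply sum_n_ext_loc; intros i Hi.
      replace (L - i)%nat with ((L - n) + (n - i))%nat by lia. rewrite Cpow_add_r.
      unfold plus; simpl; C_ring.
    - rewrite Csum_scal_l, (sum_n_rev (fun i => a i * w ^ i)%C).
      change (w ^ (L - n) * P n + sum_n (fun i => a (n - i)%nat *
        (if Nat.eqb i L then u else RtoC 0))%C n
        = w ^ (L - n) * P n + (if Nat.eqb n L then u * a 0%nat else RtoC 0))%C.
      f_equal. destruct n as [|n].
      + rewrite sum_O, Nat.sub_diag. destruct (Nat.eqb_spec 0 L); C_ring.
      + rewrite Csum_S, Csum_zero, Nat.sub_diag.
        * destruct (Nat.eqb_spec (S n) L); C_ring.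
        * intros i Hi. destruct (Nat.eqb_spec i L); [lia|C_ring]. }
  assert (Hsplit : forall (g h : nat -> R), (forall n, (n < L)%nat -> g n = h n) ->
    sum_n g L = sum_n h L + (g L - h L) :> R).
  { clear; intros g h H. destruct L as [|L]; [rewrite !sum_O; ring|].
    rewrite !Rsum_S, (sum_n_ext_loc g h L) by (intros; apply H; lia). ring. }
  rewrite (Hsplit (fun n => Cmod (conv a q n) ^ 2)
    (fun n => (Cmod w ^ 2) ^ (L - n) * Cmod (P n) ^ 2)) in HT.
  2:{ intros n Hn; rewrite Hconv by lia. destruct (Nat.eqb_spec n L); [lia|].
      rewrite Cplus_0_r, Cmod_mult, Cmod_pow, Rpow_mult_distr, <- !pow_mult.
      now rewrite (Nat.mul_comm 2). }
  rewrite (Hsplit (fun n => Cmod (q n) ^ 2) (fun n => (Cmod w ^ 2) ^ (L - n))) in HT.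
  2:{ intros n Hn; unfold q. destruct (Nat.eqb_spec n L); [lia|].
      rewrite Cplus_0_r, Cmod_pow, <- !pow_mult. now rewrite (Nat.mul_comm 2). }
  rewrite Hconv in HT by lia. unfold q in HT. rewrite Nat.eqb_refl, Nat.sub_diag in HT.
  rewrite (sum_n_ext _ (fun n => plus ((Cmod w ^ 2) ^ (L - n))
     ((-1) * ((Cmod w ^ 2) ^ (L - n) * Cmod (P n) ^ 2)))).
  2:{ intros n; unfold plus, P; simpl; ring. }
  rewrite sum_n_plus, Rsum_scal_l. unfold plus.
  change (w ^ 0)%C with (RtoC 1) in HT. rewrite Cmult_1_l in HT.
  rewrite !pow_O in HT. fold (P L).
  change (Cmod (P L + u * a 0%nat)%C ^ 2 - Cmod (P L) ^ 2 + 1 - Cmod (1 + u)%C ^ 2 <=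
   sum_n (fun k : nat => (Cmod w ^ 2) ^ (L - k)) L +
   -1 * sum_n (fun k : nat => (Cmod w ^ 2) ^ (L - k) * Cmod (P k) ^ 2) L).
  lra.
Qed.

(** Letting [L] tend to infinity in [kernel_test_vector] leaves a quadratic
    inequality in [u].  Its left-hand side is maximal at the [u] used here, with
    value [|m| ^ 2 / (1 - A ^ 2)] where [m] is [f w] times the conjugate of
    [a_0], minus 1.  As [|m| >= 1 - A B], where [B = |f w|], it follows that
    [(1 - A B) ^ 2 (1 - r ^ 2) <= (1 - A ^ 2) (1 - B ^ 2)].  The right-hand side
    equals [(1 - A B) ^ 2 - (A - B) ^ 2], so [B - A <= r (1 - A B)]. *)
Theorem Schwarz_Pick_at_0 f a :
  (forall z, unit_disc z -> Cmod (f z) < 1) -> expansion_on_disc f a ->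
  forall w, unit_disc w ->
  Cmod (f w) * (1 + Cmod (a 0%nat) * Cmod w) <= Cmod (a 0%nat) + Cmod w.
Proof.
  intros Hf Ha w Hw.
  assert (HA := Cmod_a0_lt_1 f a Hf Ha).
  assert (HA0 := Cmod_ge_0 (a 0%nat)). assert (HB0 := Cmod_ge_0 (f w)).
  assert (HB := Hf w Hw). assert (Hr0 := Cmod_ge_0 w). red in Hw.
  set (A := Cmod (a 0%nat)) in *. set (B := Cmod (f w)) in *. set (r := Cmod w) in *.
  set (m := (f w * Cconj (a 0%nat) - 1)%C).
  set (u := (RtoC (/ (1 - A ^ 2)) * m)%C).
  assert (Hr2 : 0 <= r ^ 2 < 1) by nra.
  assert (HA2 : 0 < 1 - A ^ 2) by nra.
  assert (Hlim : Cmod (f w + u * a 0%nat)%C ^ 2 - B ^ 2 + 1 - Cmod (1 + u)%C ^ 2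
     <= (1 - B ^ 2) / (1 - r ^ 2)).
  { assert (Hsq : is_lim_seq (fun n => Cmod (poly_eval a n w) ^ 2) (B ^ 2)).
    { generalize (is_lim_seq_Cmod_sqr_poly a w (f w) (RtoC 0) (Ha w Hw)).
      rewrite Cplus_0_r. apply is_lim_seq_ext; intros n; now rewrite Cplus_0_r. }
    apply (linear_recursion_limit (r ^ 2) _ _
      (fun L => sum_n (fun n => (r ^ 2) ^ (L - n) * (1 - Cmod (poly_eval a n w) ^ 2)) L)
      (fun n => 1 - Cmod (poly_eval a n w) ^ 2)
      (fun L => Cmod (poly_eval a L w + u * a 0%nat)%C ^ 2 - Cmod (poly_eval a L w) ^ 2
         + 1 - Cmod (1 + u)%C ^ 2)).
    - exact Hr2.
    - intros L. rewrite Rsum_S, Nat.sub_diag, pow_O, Rmult_1_l, <- Rsum_scal_l.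
      f_equal. apply sum_n_ext_loc; intros n Hn.
      rewrite Nat.sub_succ_l by lia. rewrite <- tech_pow_Rmult. apply Rmult_assoc.
    - apply is_lim_seq_minus'; [apply is_lim_seq_const|exact Hsq].
    - apply is_lim_seq_minus'; [|apply is_lim_seq_const].
      apply is_lim_seq_plus'; [|apply is_lim_seq_const].
      apply is_lim_seq_minus'; [|exact Hsq].
      apply is_lim_seq_Cmod_sqr_poly. now apply Ha.
    - intros L. apply (kernel_test_vector f a Hf Ha). }
  assert (Hval : Cmod (f w + u * a 0%nat)%C ^ 2 - B ^ 2 + 1 - Cmod (1 + u)%C ^ 2
     = Cmod m ^ 2 / (1 - A ^ 2)).
  { unfold B, u. rewrite Cmod_sqr_plus. rewrite (Cmod_sqr_plus 1 (_ * _)).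
    rewrite !Cmod_mult, Cmod_R, Cmod_1, !Cmult_conj. fold A.
    rewrite Rabs_pos_eq by (apply Rlt_le, Rinv_0_lt_compat, HA2).
    assert (E1 : Re (f w * (Cconj (/ (1 - A ^ 2))%R * Cconj m * Cconj (a 0%nat)))%C
       = / (1 - A ^ 2) * (Cmod m ^ 2 + Re m)).
    { rewrite Cmod2_alt. unfold m. destruct (f w), (a 0%nat); simpl; ring. }
    assert (E2 : Re (1 * (Cconj (/ (1 - A ^ 2))%R * Cconj m))%C = / (1 - A ^ 2) * Re m).
    { destruct m; simpl; ring. }
    rewrite E1, E2. field. lra. }
  rewrite Hval in Hlim.
  assert (Hm : 1 - A * B <= Cmod m).
  { generalize (Cmod_triangle (- m) (f w * Cconj (a 0%nat))).
    replace (- m + f w * Cconj (a 0%nat))%C with (RtoC 1) by (unfold m; ring).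
    rewrite Cmod_1, Cmod_opp, Cmod_mult, Cmod_conj. fold A B. lra. }
  assert (Hpick : (1 - A * B) ^ 2 * (1 - r ^ 2) <= (1 - B ^ 2) * (1 - A ^ 2)).
  { apply -> Rle_div_l in Hlim; [|lra].
    replace ((1 - B ^ 2) / (1 - r ^ 2) * (1 - A ^ 2))
      with ((1 - B ^ 2) * (1 - A ^ 2) / (1 - r ^ 2)) in Hlim by (field; lra).
    apply <- Rle_div_r in Hlim; [|lra].
    eapply Rle_trans; [|exact Hlim]. apply Rmult_le_compat_r; [lra|].
    apply pow_incr; split; [nra|exact Hm]. }
  destruct (Rle_lt_dec (B - A) (r * (1 - A * B))) as [H|H]; [lra|exfalso].
  assert (H1 : 0 <= r * (1 - A * B)) by (apply Rmult_le_pos; nra).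
  assert (H2 : (r * (1 - A * B)) ^ 2 < (B - A) ^ 2) by nra.
  nra.
Qed.

(** * The radius and the majorant *)

(** [R2] is a root of [c x ^ 2 - (alpha + 2 beta + 1) x + alpha] with
    [c = 1 - 2 beta], which is the difference of the two sides.  When [c > 0]
    it is the smaller of two positive roots; when [c <= 0] it is the only positive
    one.  In all cases the quadratic is nonnegative between 0 and [R2]. *)
Lemma R2_quadratic alpha beta r :
  0 < alpha <= 1 -> 0 < beta -> 0 <= r -> r <= R2 alpha beta ->
  2 * beta * r * (1 + r) <= (alpha - r) * (1 - r).
Proof.
  intros Ha Hb Hr0 Hr. unfold R2 in Hr.
  destruct (Req_EM_T beta (1 / 2)) as [->|Hne].
  - apply <- Rle_div_r in Hr; [|lra]. nra.
  - set (B := alpha + 2 * beta + 1) in *. set (c := 1 - 2 * beta) in *.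
    set (D := B ^ 2 - 4 * alpha * c) in *.
    assert (HD : 0 <= D) by (unfold D, B, c; nra).
    assert (Hs := sqrt_pos D). assert (Hs2 := sqrt_sqrt D HD).
    set (s := sqrt D) in *.
    assert (Hc : c <> 0) by (unfold c; lra).
    (* The factorisation over the two roots, cleared of denominators. *)
    assert (E : 4 * c * ((alpha - r) * (1 - r) - 2 * beta * r * (1 + r))
       = (B - s - 2 * c * r) * (B + s - 2 * c * r)).
    { replace ((B - s - 2 * c * r) * (B + s - 2 * c * r))
        with (B ^ 2 - s * s - 4 * B * c * r + 4 * c ^ 2 * r ^ 2) by ring.
      rewrite Hs2; unfold D, B, c; ring. }
    assert (HB : 0 < B) by (unfold B; lra).
    destruct (Rlt_le_dec 0 c) as [Hc0|Hc0].
    + apply <- Rle_div_r in Hr; [|lra]. nra.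
    + assert (Hc1 : c < 0) by lra.
      assert (Hr' : B - s <= r * (2 * c)).
      { replace (B - s) with ((B - s) / (2 * c) * (2 * c)) by (field; lra). nra. }
      assert (Hcr : c * r <= 0) by nra.
      assert (Hprod : (B - s - 2 * c * r) * (B + s - 2 * c * r) <= 0) by nra.
      nra.
Qed.

(** Here [A], [B] and [T] stand for [|a_0|], [|f z|] and the sum of the series.
    The quantity [q = (1 - A) (alpha - r)] separates the two terms: since
    [alpha <= 1], Schwarz-Pick gives [1 - alpha B >= q / (1 + A r)], while the
    condition on the radius gives [beta T <= (1 + A) q / (2 (1 + r))].  The
    comparison is then [(1 + A) (1 + A r) <= 2 (1 + r)], which is sharp as [A]
    tends to 1. *)
Lemma majorant_le_1 alpha beta A B r T :
  0 < alpha <= 1 -> 0 < beta -> 0 <= A < 1 -> 0 <= r < 1 ->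
  B * (1 + A * r) <= A + r -> T * (1 - r) <= (1 - A ^ 2) * r ->
  2 * beta * r * (1 + r) <= (alpha - r) * (1 - r) ->
  alpha * B + beta * T <= 1.
Proof.
  intros Ha Hb HA Hr HB HT Hq.
  assert (HAr : 0 <= A * r) by nra.
  assert (Hra : 0 <= alpha - r).
  { apply Rmult_le_reg_r with (1 - r); [lra|]. rewrite Rmult_0_l.
    eapply Rle_trans; [|exact Hq]. repeat apply Rmult_le_pos; lra. }
  set (q := (1 - A) * (alpha - r)).
  assert (Hq0 : 0 <= q) by (apply Rmult_le_pos; lra).
  assert (HbT : 2 * (1 + r) * (beta * T) <= (1 + A) * q).
  { apply Rmult_le_reg_r with (1 - r); [lra|].
    apply Rle_trans with (2 * beta * (1 + r) * ((1 - A ^ 2) * r)).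
    - replace (2 * (1 + r) * (beta * T) * (1 - r))
        with (2 * beta * (1 + r) * (T * (1 - r))) by ring.
      apply Rmult_le_compat_l; [|exact HT]. repeat apply Rmult_le_pos; lra.
    - replace (2 * beta * (1 + r) * ((1 - A ^ 2) * r))
        with ((1 - A ^ 2) * (2 * beta * r * (1 + r))) by ring.
      replace ((1 + A) * q * (1 - r))
        with ((1 - A ^ 2) * ((alpha - r) * (1 - r))) by (unfold q; ring).
      apply Rmult_le_compat_l; [nra|exact Hq]. }
  assert (HaB : q <= (1 - alpha * B) * (1 + A * r)) by (unfold q; nra).
  assert (Hden : (1 + A) * (1 + A * r) <= 2 * (1 + r)) by nra.
  assert (HbTq : (1 + A * r) * (beta * T) <= q).
  { apply Rmult_le_reg_l with (2 * (1 + r)); [lra|]. nra. }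
  nra.
Qed.

Theorem theorem3p2 (alpha beta : R) (Halpha : 0 < alpha <= 1) (Hbeta : 0 < beta)
    (f : C -> C) (a : nat -> C) (Hf : BA f) (Ha : expansion_on_disc f a)
    (z : C) (Hz : unit_disc z) (Hr : Cmod z <= R2 alpha beta) :
  ex_series (fun k : nat => Cmod (a (S k)) * Cmod z ^ S k) /\
  alpha * Cmod (f z)
    + beta * Series (fun k : nat => Cmod (a (S k)) * Cmod z ^ S k) <= 1.
Proof.
  destruct Hf as [_ Hf].
  assert (Hcoef := coefficient_bound f a Hf Ha).
  assert (HSP := Schwarz_Pick_at_0 f a Hf Ha z Hz).
  assert (Hq := R2_quadratic _ _ _ Halpha Hbeta (Cmod_ge_0 z) Hr).
  assert (HA := Cmod_a0_lt_1 f a Hf Ha).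
  assert (HA0 := Cmod_ge_0 (a 0%nat)). assert (HB0 := Cmod_ge_0 (f z)).
  assert (Hr0 := Cmod_ge_0 z). red in Hz. clear Hr.
  set (A := Cmod (a 0%nat)) in *. set (B := Cmod (f z)) in *. set (r := Cmod z) in *.
  assert (Hgeom : is_series (fun k => (1 - A ^ 2) * r * r ^ k) ((1 - A ^ 2) * r * / (1 - r))).
  { apply (is_series_scal_l (K := R_AbsRing) (V := R_NormedModule)
      ((1 - A ^ 2) * r) (fun k => r ^ k)).
    apply is_series_geom; rewrite Rabs_pos_eq; lra. }
  assert (Hterm : forall k, 0 <= Cmod (a (S k)) * r ^ S k <= (1 - A ^ 2) * r * r ^ k).
  { intros k. assert (0 <= r ^ S k) by (apply pow_le; lra). split.
    - apply Rmult_le_pos; [apply Cmod_ge_0|assumption].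
    - rewrite Rmult_assoc, tech_pow_Rmult. apply Rmult_le_compat_r; auto. }
  split.
  - apply (ex_series_le (K := R_AbsRing) (V := R_CompleteNormedModule) _
      (fun k => (1 - A ^ 2) * r * r ^ k)); [|eexists; exact Hgeom].
    intros k. change (Rabs (Cmod (a (S k)) * r ^ S k) <= (1 - A ^ 2) * r * r ^ k).
    rewrite Rabs_pos_eq; apply Hterm.
  - assert (Hsum : Series (fun k => Cmod (a (S k)) * r ^ S k) <= (1 - A ^ 2) * r * / (1 - r)).
    { rewrite <- (is_series_unique _ _ Hgeom). apply Series_le; [exact Hterm|].
      eexists; exact Hgeom. }
    set (T := Series _) in *.
    assert (HT : T * (1 - r) <= (1 - A ^ 2) * r) by (apply Rle_div_r; [lra|exact Hsum]).
    apply (majorant_le_1 alpha beta A B r T); auto; lra.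
Qed.
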